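(* Let $X=\{x_1,\ldots,x_m\}$ be a finite metric space with $m$ distinct points and of diameter at most one, let $r_i=(d(x_i,x_1),\ldots,d(x_i,x_m))\in\mathbb{R}^m$ for $1\le i\le m$, and let $P_X=\operatorname{conv}\{r_1,\ldots,r_m\}\subseteq\mathbb{R}^m$. Then $S'(X)$ is affinely homeomorphic to $P_X$. More precisely, let $u=(u_n)_{n\ge1}$ be any sequence enumerating $X$ (possibly with repetitions), let $n_1<\cdots<n_m$ be the indices at which points of $X$ occur for the first time in $u$, and let $\sigma$ be the permutation of $\{1,\ldots,m\}$ with $u_{n_k}=x_{\sigma(k)}$. Then the map which deletes the repeated coordinates, $z\mapsto(z_{n_1},\ldots,z_{n_m})$, followed by the coordinate permutation $(y_1,\ldots,y_m)\mapsto(y_{\sigma^{-1}(1)},\ldots,y_{\sigma^{-1}(m)})$, restricts to an affine homeomorphism of $S'_u(X)$ onto $P_X$.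
   Context: The construction $S'$: Let $(X,d)$ be a nonempty separable metric space with $\operatorname{diam}(X)\le 1$. For a sequence $D=(d_n)_{n\ge 1}$ (repetitions allowed) whose terms form a dense subset of $X$, put $\iota_D:X\to[0,1]^{\mathbb{N}}$, $\iota_D(x)=(d(x,d_1),d(x,d_2),\ldots)$, and let $S'_D(X)$ be the closed convex hull of $\iota_D(X)$ in $[0,1]^{\mathbb{N}}$ (product topology). Up to affine homeomorphism $S'_D(X)$ does not depend on the choice of $D$ (a known result of Sabok), and $S'(X)$ denotes $S'_D(X)$ for any such $D$. An affine homeomorphism is an affine bijection that is a homeomorphism. *)

(* Defs.v *)
From HB Require Import structures.
From mathcomp Require Import all_boot all_order all_algebra all_fingroup.
From mathcomp Require Import all_classical all_reals all_analysis.

Set Implicit Arguments.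
Unset Strict Implicit.
Unset Printing Implicit Defensive.

Import Order.TTheory GRing.Theory Num.Theory.
Import numFieldNormedType.Exports.

Local Open Scope classical_set_scope.
Local Open Scope ring_scope.

(* The real sequences with the product topology and the pointwise vector
   space structure; a named copy is needed because [nat -> R] has no canonical
   topology. *)
Definition Rseq (R : realType) : Type := {ptws nat -> R}.

HB.instance Definition _ (R : realType) := Uniform.on (Rseq R).
HB.instance Definition _ (R : realType) :=
  GRing.Lmodule.copy (Rseq R) (nat -> R).

(* No new structure: this only declares the join of the library's topology and
   module structure on matrices. *)
HB.instance Definition _ (K : numFieldType) (m n : nat) :=
  Topological.on 'M[K]_(m, n).

Section ConvexHulls.
Context {R : realType}.

Definition convex_hull {E : lmodType R} (A : set E) : set E :=
  smallest (fun C : set E => convex_set C) A.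

Definition closed_convex_hull {E : preTopologicalLmodType R} (A : set E) :
    set E :=
  smallest (fun C : set E => closed C /\ convex_set C) A.

End ConvexHulls.

Section AffineHomeomorphisms.
Context {R : realType} {E F : preTopologicalLmodType R}.
Implicit Types (A : set E) (B : set F) (f : E -> F).

Definition affine_on A f : Prop :=
  forall (x y : E) (t : R), A x -> A y -> 0 <= t <= 1 ->
    f (t *: x + (1 - t) *: y) = t *: f x + (1 - t) *: f y.

(* Only the values of [f] on [A] matter.  Since [f] is a bijection from [A]
   onto [B], the function [g] is its inverse on [B]. *)
Definition affine_homeomorphism A B f : Prop :=
  [/\ set_bij A B f,
      affine_on A f,
      {within A, continuous f} &
      exists g : F -> E,
        {in A, cancel f g} /\ {within B, continuous g}].

Definition affinely_homeomorphic A B : Prop :=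
  exists f, affine_homeomorphism A B f.

End AffineHomeomorphisms.

Definition diameter {R : realType} (X : metricType R) : \bar R :=
  ereal_sup [set (mdist p.1 p.2)%:E | p in [set: X * X]].

(* Sequences are indexed from 0. *)
Definition dist_embedding {R : realType} {X : metricType R} (D : nat -> X)
    (p : X) : Rseq R :=
  fun n => mdist p (D n).

(* The hull is taken in the space of all real sequences; [Sprime_sub_cube]
   shows that it lies in [0,1]^N, which is closed and convex, so that it is
   also the closed convex hull in [0,1]^N. *)
Definition Sprime {R : realType} {X : metricType R} (D : nat -> X) :
    set (Rseq R) :=
  closed_convex_hull (range (dist_embedding D)).

Definition dist_row {R : realType} {X : metricType R} {m : nat}
    (x : 'I_m -> X) (i : 'I_m) : 'rV[R]_m :=
  \row_j mdist (x i) (x j).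

Definition dist_polytope {R : realType} {X : metricType R} {m : nat}
    (x : 'I_m -> X) : set 'rV[R]_m :=
  convex_hull (range (dist_row x)).

Definition first_occurrences {T : Type} (u : nat -> T) : set nat :=
  [set k | forall i, (i < k)%N -> u i <> u k].

Definition select_coords {R : realType} {m : nat} (n : 'I_m -> nat)
    (z : Rseq R) : 'rV[R]_m :=
  \row_k z (n k).

Definition permute_coords {R : realType} {m : nat} (s : 'S_m)
    (y : 'rV[R]_m) : 'rV[R]_m :=
  \row_j y ord0 ((s^-1)%g j).

Definition unit_cube (R : realType) : set (Rseq R) :=
  [set z | forall n, 0 <= z n <= 1].

Lemma unit_cube_closed (R : realType) : closed (@unit_cube R).
Proof.
have -> : @unit_cube R =
    \bigcap_(n in [set: nat]) [set z : Rseq R | z n \in `[0, 1]%R].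
  by apply/seteqP; split=> z /= h n; [move=> _ /= | move: (h n I)];
    rewrite /= in_itv /= ?h.
apply: closed_bigI => n _.
apply: (@preimage_closed _ _ (fun z : Rseq R => z n) [set` `[0%R, 1%R]]) => [z _|].
  exact: (@proj_continuous nat (fun=> R) n z).
exact: itv_closed.
Qed.

Lemma unit_cube_convex (R : realType) : convex_set (@unit_cube R).
Proof.
move=> x y t; rewrite !inE => hx hy n.
have /andP[x0 x1] := hx n; have /andP[y0 y1] := hy n.
have t0 : 0 <= t%:num by [].
have t1 : t%:num <= 1 by [].
change (0 <= t%:num * x n + (1 - t%:num) * y n <= 1).
have t1' : 0 <= 1 - t%:num by rewrite subr_ge0.
rewrite addr_ge0 ?mulr_ge0//=.
rewrite -[leRHS](subrKC t%:num); apply: lerD; first exact: ler_piMr.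
exact: ler_piMr.
Qed.

Lemma Sprime_sub_cube (R : realType) (X : metricType R) (D : nat -> X) :
  (diameter X <= 1)%E -> Sprime D `<=` @unit_cube R.
Proof.
move=> dX; apply: smallest_sub.
  by split; [exact: unit_cube_closed | exact: unit_cube_convex].
move=> _ [p _ <-] n; rewrite /dist_embedding mdist_ge0 /=.
by rewrite -lee_fin; apply: le_trans dX; apply: ereal_sup_ubound; exists (p, D n).
Qed.

(* Main.v *)
Require Import Defs.
From HB Require Import structures.
From mathcomp Require Import all_boot all_order all_algebra all_fingroup.
From mathcomp Require Import all_classical all_reals all_analysis.

Set Implicit Arguments.
Unset Strict Implicit.
Unset Printing Implicit Defensive.

Import Order.TTheory GRing.Theory Num.Theory.
Import numFieldNormedType.Exports.

Local Open Scope classical_set_scope.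
Local Open Scope ring_scope.

(* If [u] enumerates [X] and [u (n j) = x j], then selecting the coordinates
   [n j] is inverted on [Sprime u] by the linear map that repeats coordinate [j]
   at every [k] with [u k = x j]: the equations [z k = z (n j)] are closed
   convex conditions that hold on the embedded points, hence on their closed
   convex hull.  Selection maps [Sprime u] into [P_X] because [P_X], a linear
   image of a compact simplex, is closed.  A dense sequence in a finite metric
   space enumerates it, so that the first claim is a special case.  The
   coordinate permutation amounts to taking the indices [n] in another order. *)

(** * Continuity by coordinates, and dense subsets of finite spaces *)

Lemma continuous_to_mx (T U : topologicalType) m n (f : T -> 'M[U]_(m, n)) :
  (forall i j, continuous (fun t => f t i j)) -> continuous f.
Proof.
move=> cf t A [P P_nbhs sPA].
(* There are finitely many entries, so the entrywise neighbourhoods intersect in a neighbourhood. *)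
apply: (filterS (P := fun s => forall i j, P i j (f s i j))).
  by move=> s Ps; exact: sPA.
by apply: filter_forall => i; apply: filter_forall => j; exact: (cf i j t).
Qed.

Lemma continuous_to_Rseq (R : realType) (T : topologicalType)
    (f : T -> Rseq R) :
  (forall k, continuous (fun t => f t k)) -> continuous f.
Proof.
(* The product topology is the supremum of the topologies pulled back along the coordinates, so only
   preimages of open sets [W] under one coordinate [k] have to be treated. *)
move=> cf t; apply/(@cvg_sup _ _ _ (f @ t) (f t)) => k A [B [[W oW WB] Bft] BA].
apply: (@filterS _ _ _ B) => //.
rewrite -WB; apply: (cf k t); apply: open_nbhs_nbhs; split => //.
by move: Bft; rewrite -WB.
Qed.

Lemma Rseq_coord_continuous (R : realType) k :
  continuous (fun z : Rseq R => z k).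
Proof. by move=> z; exact: (@proj_continuous nat (fun=> R) k z). Qed.

Lemma continuous_sum (R : realType) (T : topologicalType) (I : finType)
    (f : I -> T -> R) :
  (forall i, continuous (f i)) -> continuous (fun t => \sum_i f i t).
Proof.
move=> cf t; apply: (@cvg_big R I +%R 0 xpredT) => [|i _].
  exact: add_continuous.
exact: cf.
Qed.

(** Finite sets are closed in a T1 space. The complement of a point is finite, so each point is open
    and a dense set must meet it. *)
Lemma dense_finite_setT (T : topologicalType) (A : set T) :
  accessible_space T -> finite_set [set: T] -> dense A -> A = [set: T].
Proof.
move=> accT finT dA; apply/seteqP; split=> // p _.
have op : open [set p].
  rewrite -[[set p]]setCK openC; apply: accessible_finite_set_closed.1 accT _ _.
  exact: sub_finite_set finT.
by have [_ [-> Ap]] := dA _ (ex_intro _ p erefl) op.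
Qed.

(** * Convex hulls of finite families as images of a simplex *)

Section Convexity.
Context {R : realType}.

(** Trades the bundled unit-interval parameter of [convex_set] for a real number with bounds. *)
Lemma convex_setP (E : lmodType R) (C : set E) :
  convex_set C <->
  (forall x y (t : R), C x -> C y -> 0 <= t <= 1 -> C (t *: x + (1 - t) *: y)).
Proof.
split=> [cC x y t Cx Cy /andP[t0 t1]|cC x y t /set_mem Cx /set_mem Cy].
  by apply/set_mem; apply: (cC x y (Itv01 t0 t1)); apply/mem_set.
by apply/mem_set; apply: cC => //; rewrite ge0 le1.
Qed.

Lemma convex_hull_convex (E : lmodType R) (A : set E) :
  convex_set (convex_hull A).
Proof.
apply/convex_setP => x y t Hx Hy t01 B [cB AB].
by apply: (convex_setP B).1 => //; [exact: Hx|exact: Hy].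
Qed.

Lemma closed_convex_hull_convex (E : preTopologicalLmodType R) (A : set E) :
  convex_set (closed_convex_hull A).
Proof.
apply/convex_setP => x y t Hx Hy t01 B [[clB cB] AB].
by apply: (convex_setP B).1 => //; [exact: Hx|exact: Hy].
Qed.

Lemma preimage_convex (E F : lmodType R) (f : {linear E -> F}) (C : set F) :
  convex_set C -> convex_set (f @^-1` C).
Proof.
move=> /convex_setP cC; apply/convex_setP => x y t Cx Cy t01 /=.
by rewrite linearD !linearZ; exact: cC.
Qed.

(** Induction on the number of points: split off the first one and divide the other weights by their
    sum [1 - w ord0]. *)
Lemma convex_set_sum (E : lmodType R) (C : set E) m
    (v : 'I_m -> E) (w : 'I_m -> R) :
  convex_set C -> (forall i, C (v i)) -> (forall i, 0 <= w i) ->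
  \sum_i w i = 1 -> C (\sum_i w i *: v i).
Proof.
move=> /convex_setP cC; elim: m v w => [|m IH] v w Cv w0.
  by rewrite big_ord0 => /esym/eqP; rewrite oner_eq0.
rewrite !big_ord_recl/= => sw.
have rE : \sum_(i < m) w (lift ord0 i) = 1 - w ord0.
  by rewrite -sw addrC addKr.
have w1 : w ord0 <= 1 by rewrite -subr_ge0 -rE; exact: sumr_ge0.
(* If the first weight is 1, the others cannot be renormalised, but being nonnegative with sum 0
   they all vanish. *)
have [w01|w01] := eqVneq (w ord0) 1.
  have wl i : w (lift ord0 i) = 0.
    move/eqP: rE; rewrite w01 subrr psumr_eq0// => /allP/(_ i).
    by rewrite mem_index_enum => /(_ isT)/eqP.
  by rewrite w01 scale1r big1 ?addr0// => i _; rewrite wl scale0r.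
have r_gt0 : 0 < 1 - w ord0 by rewrite subr_gt0 lt_neqAle w01.
have -> : \sum_(i < m) w (lift ord0 i) *: v (lift ord0 i) = (1 - w ord0) *:
    \sum_i ((1 - w ord0)^-1 * w (lift ord0 i)) *: v (lift ord0 i).
  rewrite scaler_sumr; apply: eq_bigr => i _.
  by rewrite scalerA mulrA divff ?gt_eqF// mul1r.
apply: cC => //; last by rewrite w0.
apply: IH => // [i|]; first by rewrite mulr_ge0// invr_ge0 ltW.
by rewrite -mulr_sumr rE mulVf ?gt_eqF.
Qed.

Definition simplex m : set 'rV[R]_m :=
  [set w | (forall i, 0 <= w ord0 i) /\ \sum_i w ord0 i = 1].

(** Nonnegative weights with sum 1 are at most 1, so the simplex is a closed subset of a compact
    cube. *)
Lemma simplex_compact m : compact (@simplex m).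
Proof.
have -> : @simplex m = [set w | forall i, w ord0 i \in `[0, 1]] `&`
    [set w | \sum_i w ord0 i = 1].
  apply/seteqP; split=> w [w0 w1]; split=> // i; last first.
    by have := w0 i; rewrite in_itv/= => /andP[].
  rewrite in_itv/= w0 -w1 (bigD1 i)//= lerDl.
  exact: sumr_ge0.
apply: compact_closedI.
  apply: (@rV_compact R m (fun=> [set` `[0%R, 1%R]])) => i.
  exact: segment_compact.
apply: (@preimage_closed _ _ (fun w : 'rV[R]_m => \sum_i w ord0 i) [set 1]).
  by move=> w _; apply: continuous_sum => i; exact: coord_continuous.
exact: closed_eq.
Qed.

Lemma mulmxr_continuous m n (V : 'M[R]_(m, n)) :
  continuous (fun w : 'rV[R]_m => w *m V).
Proof.
apply: continuous_to_mx => i j.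
under eq_fun do rewrite mxE.
apply: continuous_sum => k w.
exact: (@cvgMr_tmp R _ (nbhs w) _ _ _ _ (@coord_continuous R 1 m i k w)).
Qed.

(** The image of the simplex is convex and contains each [v i] as the image of a unit vector;
    conversely its elements are convex combinations of the [v i]. *)
Lemma convex_hull_finite m n (v : 'I_m -> 'rV[R]_n) :
  convex_hull (range v) = [set w *m \matrix_i v i | w in @simplex m].
Proof.
apply/seteqP; split.
  apply: smallest_sub.
    apply/convex_setP => _ _ t [w [w0 w1] <-] [z [z0 z1] <-] /andP[t0 t1].
    exists (t *: w + (1 - t) *: z); last by rewrite mulmxDl -!scalemxAl.
    split=> [i|]; first by rewrite !mxE addr_ge0 ?mulr_ge0 ?subr_ge0.
    under eq_bigr do rewrite !mxE.
    by rewrite big_split/= -!mulr_sumr w1 z1 !mulr1 subrKC.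
  move=> _ [i _ <-]; exists (delta_mx ord0 i); last by rewrite -rowE rowK.
  split=> [j|]; first by rewrite mxE ler0n.
  rewrite (bigD1 i)//= big1 ?mxE ?eqxx ?addr0// => j /negPf ji.
  by rewrite mxE ji.
move=> _ [w [w0 w1] <-]; rewrite mulmx_sum_row.
apply: convex_set_sum => // [|i]; first exact: convex_hull_convex.
by rewrite rowK; apply: sub_gen_smallest; exists i.
Qed.

Lemma convex_hull_finite_closed m n (v : 'I_m -> 'rV[R]_n) :
  closed (convex_hull (range v)).
Proof.
rewrite convex_hull_finite; apply: compact_closed; first exact: norm_hausdorff.
apply: continuous_compact; last exact: simplex_compact.
exact/continuous_subspaceT/mulmxr_continuous.
Qed.

End Convexity.

(** * Selecting and repeating coordinates *)

Section CoordinateSelection.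
Context {R : realType} {m : nat}.

Lemma select_coords_linear (n : 'I_m -> nat) :
  linear (@select_coords R m n).
Proof. by move=> a z z'; apply/rowP => j; rewrite !mxE. Qed.

HB.instance Definition _ (n : 'I_m -> nat) :=
  GRing.isLinear.Build R (Rseq R) 'rV[R]_m _ (select_coords n)
    (select_coords_linear n).

Lemma select_coords_continuous (n : 'I_m -> nat) :
  continuous (@select_coords R m n).
Proof.
apply: continuous_to_mx => i j; under eq_fun do rewrite mxE.
exact: Rseq_coord_continuous.
Qed.

Definition repeat_coords (c : nat -> 'I_m) (y : 'rV[R]_m) : Rseq R :=
  fun k => y ord0 (c k).

Lemma repeat_coords_linear (c : nat -> 'I_m) : linear (repeat_coords c).
Proof. by move=> a y y'; apply/funext => k; rewrite /repeat_coords !mxE. Qed.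

HB.instance Definition _ (c : nat -> 'I_m) :=
  GRing.isLinear.Build R 'rV[R]_m (Rseq R) _ (repeat_coords c)
    (repeat_coords_linear c).

Lemma repeat_coords_continuous (c : nat -> 'I_m) :
  continuous (repeat_coords c).
Proof. by apply: continuous_to_Rseq => k; exact: coord_continuous. Qed.

(** The composite in the other order fixes only the sequences with [z k = z (n (c k))] for all [k];
    those in [Sprime u] are treated by [selK] below. *)
Lemma repeat_coordsK (c : nat -> 'I_m) (n : 'I_m -> nat) :
  cancel n c -> cancel (repeat_coords c) (select_coords n).
Proof. by move=> nK y; apply/rowP => j; rewrite mxE /repeat_coords nK. Qed.

Context {X : metricType R} (x : 'I_m -> X) (u : nat -> X) (n : 'I_m -> nat).

(** Serves both claims of the theorem: the indices come either from a choice of occurrences or from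
    the given [n] reordered by [s]. *)
Lemma select_coords_affine_homeomorphism :
  bijective x -> (forall j, u (n j) = x j) ->
  affine_homeomorphism (Sprime u) (dist_polytope x) (select_coords n).
Proof.
case=> y xK yK un; pose c k := y (u k).
have nK : cancel n c by move=> j; rewrite /c un xK.
(* The two maps exchange the generators of the two hulls; minimality of each hull then extends this
   to [selS] and [repP]. *)
have selE i : select_coords n (dist_embedding u (x i)) = dist_row x i.
  by apply/rowP => j; rewrite !mxE /dist_embedding un.
have repE i : repeat_coords c (dist_row x i) = dist_embedding u (x i).
  by apply/funext => k; rewrite /repeat_coords mxE /c yK.
have selS z : Sprime u z -> dist_polytope x (select_coords n z).
  move: z; apply: smallest_sub => [|_ [p _ <-]]; last first.
    by apply: sub_gen_smallest; exists (y p) => //; rewrite -selE yK.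
  split; last exact/preimage_convex/convex_hull_convex.
  apply: preimage_closed; last exact: convex_hull_finite_closed.
  by move=> z _; exact: select_coords_continuous.
have repP z : dist_polytope x z -> Sprime u (repeat_coords c z).
  move: z; apply: smallest_sub => [|_ [i _ <-]].
    exact/preimage_convex/closed_convex_hull_convex.
  by apply: sub_gen_smallest; exists (x i).
have selK z : Sprime u z -> repeat_coords c (select_coords n z) = z.
  move=> Sz; apply/funext => k; rewrite /repeat_coords mxE; apply/eqP.
  (* As a vanishing difference, the equation defines the preimage of the closed set {0} under a
     continuous map. *)
  rewrite -subr_eq0; apply/eqP.
  move: z Sz; apply: smallest_sub => [|_ [p _ <-]]; last first.
    by rewrite /= /dist_embedding un /c yK subrr.
  split.
    apply: (@preimage_closed _ _ (fun z : Rseq R => z (n (c k)) - z k) [set 0]).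
      move=> z _.
      exact: (cvgB (@Rseq_coord_continuous R (n (c k)) z)
                   (@Rseq_coord_continuous R k z)).
    exact: closed_eq.
  apply/convex_setP => z z' t /= /eqP + /eqP.
  rewrite !subr_eq0 => /eqP zE /eqP z'E _.
  change (t * z (n (c k)) + (1 - t) * z' (n (c k)) -
    (t * z k + (1 - t) * z' k) = 0).
  by rewrite zE z'E subrr.
split.
- split=> [z /selS //|z z' /set_mem Sz /set_mem Sz' zz'|z Pz].
    by rewrite -(selK z)// -(selK z')// zz'.
  by exists (repeat_coords c z); [exact: repP|exact: repeat_coordsK].
- by move=> z z' t _ _ _; rewrite linearD !linearZ.
- exact/continuous_subspaceT/select_coords_continuous.
exists (repeat_coords c); split; last first.
  exact/continuous_subspaceT/repeat_coords_continuous.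
by move=> z /set_mem /selK.
Qed.

End CoordinateSelection.

Theorem proposition2p2 (R : realType) (X : metricType R) (m : nat)
    (x : 'I_m -> X) (x_bij : bijective x) (diamX : (diameter X <= 1)%E) :
  (forall D : nat -> X, dense (range D) ->
     affinely_homeomorphic (Sprime D) (dist_polytope x)) /\
  (forall u : nat -> X, range u = [set: X] ->
   forall n : 'I_m -> nat,
     {homo n : i j / (i < j)%N} ->
     range n = first_occurrences u ->
   forall s : 'S_m, (forall k : 'I_m, u (n k) = x (s k)) ->
     affine_homeomorphism (Sprime u) (dist_polytope x)
       (permute_coords s \o select_coords n)).
Proof.
split=> [D dD|u _ n _ _ s un].
  have rD : range D = [set: X].
    apply: dense_finite_setT => //.
      exact/hausdorff_accessible/metric_hausdorff.
    have -> : [set: X] = range x.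
      apply/seteqP; split=> // p _; have [y _ yK] := x_bij.
      by exists (y p).
    exact: finite_image.
  have /choice[n Dn] j : exists k, D k = x j.
    have [k _ <-] : range D (x j) by rewrite rD.
    by exists k.
  by exists (select_coords n); exact: select_coords_affine_homeomorphism.
have -> : permute_coords s \o select_coords n =
    @select_coords R m (n \o (s^-1)%g).
  by apply/funext => z; apply/rowP => j; rewrite !mxE.
(* Entry [j] is read at the index [n (s^-1 j)], where [u] takes the value [x (s (s^-1 j)) = x j]. *)
by apply: select_coords_affine_homeomorphism => // j; rewrite /= un permKV.
Qed.
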